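(* Let $\Omega\subset\mathbb{R}^d$ be a bounded open convex set. Given any full packing $\{B_i\}$ of $\Omega$ by balls, there exists a function $\varphi:\Omega\to\mathbb{R}$, convex and locally affine a.e., whose pieces are $A_i=B_i$ (i.e., the connected components of $\{x\in\Omega:\varphi\text{ is affine on a neighborhood of }x\}$ are exactly the balls $B_i$), such that for each $i$, $\nabla\varphi$ maps $B_i$ to the center of $B_i$.
   Context: A full packing of $\Omega$ by balls is a countable collection of disjoint open balls $B_i=\{x:|x-x_i|<r_i\}$ in $\Omega$, with centers $x_i$ and radii $r_i$, such that the union $\bigsqcup_i B_i$ is an open set of full Lebesgue measure in $\Omega$. A function $\varphi:\Omega\to\mathbb{R}$ is locally affine a.e. if, for a.e. $x\in\Omega$, $\varphi$ is affine on some neighborhood of $x$. *)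

(* Defs.v *)
From HB Require Import structures.
From mathcomp Require Import all_boot all_order all_algebra.
From mathcomp Require Import all_classical all_reals all_analysis.

Set Implicit Arguments.
Unset Strict Implicit.
Unset Printing Implicit Defensive.

Import Order.TTheory GRing.Theory Num.Theory.
Import numFieldNormedType.Exports.

Local Open Scope classical_set_scope.
Local Open Scope ring_scope.

(* The norm that the library puts on 'rV[R]_d is the sup norm, with the
   Euclidean topology and the same bounded sets; balls need the Euclidean one. *)
Definition enorm (R : realType) (d : nat) (v : 'rV[R]_d) : R :=
  Num.sqrt (\sum_(j < d) v 0 j ^+ 2).

Definition eball (R : realType) (d : nat) (c : 'rV[R]_d) (r : R) :
  set 'rV[R]_d := [set x | enorm (x - c) < r].

Section lebesgue_tuple.
Context {R : realType}.
Local Notation T := (measurableTypeR R).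
Local Open Scope ereal_scope.

Section lebesgue_cons.
Context {n : nat} (m : {sigma_finite_measure set (n.-tuple T) -> \bar R}).

Definition lebesgue_cons : set (n.+1.-tuple T) -> \bar R :=
  pushforward (@lebesgue_measure R \x m)
    (fun p : T * n.-tuple T => cons_tuple p.1 p.2).

Let measurable_cons_tuple :
  measurable_fun [set: T * n.-tuple T] (fun p => cons_tuple p.1 p.2).
Proof. exact: (measurable_cons measurable_fst measurable_snd). Qed.

Let lebesgue_cons0 : lebesgue_cons set0 = 0.
Proof. by rewrite /lebesgue_cons /pushforward preimage_set0 measure0. Qed.

Let lebesgue_cons_ge0 A : 0 <= lebesgue_cons A.
Proof. exact: measure_ge0. Qed.

Let lebesgue_cons_sigma_additive : semi_sigma_additive lebesgue_cons.
Proof.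
move=> F mF tF mUF; rewrite /lebesgue_cons /pushforward preimage_bigcup.
apply: measure_semi_sigma_additive.
- by move=> k; rewrite -[X in measurable X]setTI; exact: measurable_cons_tuple.
- apply/trivIsetP => i j _ _ ij; rewrite -preimage_setI.
  by move/trivIsetP : tF => /(_ _ _ _ _ ij) ->//; rewrite preimage_set0.
- rewrite -preimage_bigcup -[X in measurable X]setTI.
  exact: measurable_cons_tuple.
Qed.

HB.instance Definition _ := isMeasure.Build _ _ _ lebesgue_cons
  lebesgue_cons0 lebesgue_cons_ge0 lebesgue_cons_sigma_additive.

Let lebesgue_cons_sigma_finite : sigma_finite setT lebesgue_cons.
Proof.
have /sigma_finiteP[F [TF ndF Foo]] := sigma_finiteT (@lebesgue_measure R).
have /sigma_finiteP[G [TG ndG Goo]] := sigma_finiteT m.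
pose g (t : n.+1.-tuple T) : T * n.-tuple T :=
  (tnth t ord0, [tuple of behead t]).
have mg : measurable_fun setT g.
  apply: measurable_fun_pair; first exact: measurable_tnth.
  exact: measurable_behead.
exists (fun k => g @^-1` (F k `*` G k)).
  apply/seteqP; split=> // t _; rewrite -preimage_bigcup.
  have [i _ Fi] : (\bigcup_i F i) (g t).1 by rewrite -TF.
  have [j _ Gj] : (\bigcup_i G i) (g t).2 by rewrite -TG.
  exists (maxn i j) => //; split.
  - by move: Fi; exact/subsetPset/ndF/leq_maxl.
  - by move: Gj; exact/subsetPset/ndG/leq_maxr.
move=> k; have [mF Fk] := Foo k; have [mG Gk] := Goo k; split.
  by rewrite -[X in measurable X]setTI; apply: mg => //; exact: measurableX.
rewrite /lebesgue_cons /pushforward -comp_preimage (_ : g \o _ = id).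
  by rewrite preimage_id product_measure1E// lte_mul_pinfty// ge0_fin_numE.
by apply/funext => -[x t]; congr pair; exact: val_inj.
Qed.

HB.instance Definition _ := Measure_isSigmaFinite.Build _ _ _ lebesgue_cons
  lebesgue_cons_sigma_finite.

End lebesgue_cons.

(* Lebesgue measure on R^n, as the iterated product of the one-dimensional
   one, on the product (that is, Borel) sigma-algebra of n.-tuple R. *)
Fixpoint lebesgue_tuple n :
    {sigma_finite_measure set (n.-tuple T) -> \bar R} :=
  match n with
  | 0 => \d_([tuple] : 0.-tuple T)
  | k.+1 => lebesgue_cons (lebesgue_tuple k)
  end.

Lemma lebesgue_tuple_box n (A : 'I_n -> set T) :
  (forall i, measurable (A i)) ->
  lebesgue_tuple n [set t | forall i, A i (tnth t i)] =
  \prod_(i < n) lebesgue_measure (A i).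
Proof.
elim: n A => [|n IH] A mA /=.
  rewrite big_ord0 diracE mem_set//; by case.
rewrite big_ord_recl -IH//.
rewrite /lebesgue_cons /pushforward.
rewrite -product_measure1E//.
- congr (_ _); apply/seteqP; split => [[x t] /= h|[x t] [/= h1 h2] i].
    split; first exact: (h ord0).
    by move=> i /=; have := h (lift ord0 i); rewrite tnthS.
  case: (unliftP ord0 i) => [j|] ->; last by [].
  rewrite tnthS; exact: h2.
- rewrite (_ : [set t | _] = \bigcap_(i in [set: 'I_n])
      (fun t : n.-tuple T => tnth t i) @^-1` A (lift ord0 i)).
    apply: fin_bigcap_measurable => // i _.
    rewrite -[X in measurable X]setTI; exact: measurable_tnth.
  by apply/seteqP; split => t /= h i; [move=> _|]; apply: h.
Qed.

End lebesgue_tuple.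

(* lebesgue_tuple is a Borel measure: negligible means contained in a Borel set
   of measure 0, which is being null for the completed Lebesgue measure. *)
Definition lebesgue_null (R : realType) (d : nat) (N : set 'rV[R]_d) : Prop :=
  (lebesgue_tuple (R := R) d).-negligible
    [set t : d.-tuple (measurableTypeR R) | N (\row_(j < d) tnth t j)].

Definition full_packing (R : realType) (d : nat) (Omega : set 'rV[R]_d)
    (I : countType) (c : I -> 'rV[R]_d) (r : I -> R) : Prop :=
  let B i := eball (c i) (r i) in
  [/\ forall i, 0 < r i,
      forall i, B i `<=` Omega,
      trivIset setT B,
      open (\bigcup_i B i) &
      lebesgue_null (Omega `\` \bigcup_i B i)].

Definition affine_on (R : realType) (d : nat) (U : set 'rV[R]_d)
    (phi : 'rV[R]_d -> R) : Prop :=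
  exists (a : 'rV[R]_d) (b : R),
    forall y, U y -> phi y = \sum_(j < d) a 0 j * y 0 j + b.

(* phi : Omega -> R is encoded by a function on the whole space, so the
   neighbourhood is required to lie in Omega. *)
Definition affine_locus (R : realType) (d : nat) (Omega : set 'rV[R]_d)
    (phi : 'rV[R]_d -> R) : set 'rV[R]_d :=
  [set x | Omega x /\
    exists U, [/\ nbhs x U, U `<=` Omega & affine_on U phi]].

Definition locally_affine_ae (R : realType) (d : nat) (Omega : set 'rV[R]_d)
    (phi : 'rV[R]_d -> R) : Prop :=
  lebesgue_null (Omega `\` affine_locus Omega phi).

Definition pieces (R : realType) (d : nat) (Omega : set 'rV[R]_d)
    (phi : 'rV[R]_d -> R) : set (set 'rV[R]_d) :=
  [set connected_component (affine_locus Omega phi) x |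
    x in affine_locus Omega phi].

Definition gradient (R : realType) (d : nat) (phi : 'rV[R]_d -> R)
    (x : 'rV[R]_d) : 'rV[R]_d :=
  \row_(j < d) 'D_(delta_mx 0 j) phi x.

(* Main.v *)
From HB Require Import structures.
Require Import Defs.
From mathcomp Require Import all_boot all_order all_algebra.
From mathcomp Require Import all_classical all_reals all_analysis.
From mathcomp Require Import ring lra.

Import Order.TTheory GRing.Theory Num.Theory.
Import numFieldNormedType.Exports.

Local Open Scope classical_set_scope.
Local Open Scope ring_scope.

(* Idea: take phi(x) = sup_i (c_i . x + (r_i^2 - |c_i|^2) / 2), which equals
   (|x|^2 - inf_i pow_i(x)) / 2 for the power pow_i(x) = |x - c_i|^2 - r_i^2 of x
   with respect to the i-th sphere. Since the balls are disjoint, at a point of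
   B_i the power pow_i is the only negative one, so B_i lies in the i-th power
   cell and phi is affine of slope c_i there. Conversely, if phi is affine on
   an open V, all balls meeting V have the same centre, hence there is only one
   of them; the packing is dense, so V lies in the closure of that ball, and
   therefore in the ball itself. *)

(** * Euclidean inner product and gradients of affine functions *)

Lemma continuous_big_add {R : realType} {T : topologicalType} {d : nat}
    (f : 'I_d -> T -> R) :
  (forall j, continuous (f j)) -> continuous (fun x => \sum_(j < d) f j x).
Proof.
move=> cf; rewrite (_ : (fun x => _) = \sum_(j < d) f j); last first.
  by apply/funext => x; rewrite fct_sumE.
elim/big_ind : _ => // [|g h cg ch] x; first exact: cvg_cst.
by apply: cvgD; [exact: cg|exact: ch].
Qed.

(** This is literally the sum in [affine_on], so the two forms are convertible. *)
Definition edot {R : realType} {d : nat} (a y : 'rV[R]_d) : R :=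
  \sum_(j < d) a 0 j * y 0 j.

Lemma edot_linear {R : realType} {d : nat} (a : 'rV[R]_d) : linear (edot a).
Proof.
move=> k y z; rewrite /edot scaler_sumr -big_split/=.
by apply: eq_bigr => j _; rewrite !mxE mulrDr mulrCA.
Qed.

HB.instance Definition _ (R : realType) (d : nat) (a : 'rV[R]_d) :=
  GRing.isLinear.Build R 'rV[R]_d R *%R (edot a) (edot_linear a).

Lemma edot_continuous {R : realType} {d : nat} (a : 'rV[R]_d) :
  continuous (edot a).
Proof.
refine (@continuous_big_add R _ d (fun j (y : 'rV[R]_d) => a 0 j * y 0 j) _) => j y.
apply: continuousM; [exact: cst_continuous|exact: coord_continuous].
Qed.

Lemma edot_delta {R : realType} {d : nat} (a : 'rV[R]_d) (j : 'I_d) :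
  edot a (delta_mx 0 j) = a 0 j.
Proof.
rewrite /edot (bigD1 j)//= mxE !eqxx mulr1 big1 ?addr0// => i ij.
by rewrite mxE (negbTE ij) andbF mulr0.
Qed.

(** The first-order error vanishes identically near [z], so uniqueness of the differential gives
    [edot a]. This both computes gradients inside the balls and identifies slopes on the affine
    locus. *)
Lemma near_affine_diff {R : realType} {d : nat} (phi : 'rV[R]_d -> R)
    (a : 'rV[R]_d) (b : R) (z : 'rV[R]_d) :
  (\forall y \near z, phi y = edot a y + b) ->
  differentiable phi z /\ gradient phi z = a.
Proof.
move=> phiE.
have E (e : R) : 0 < e -> \forall h \near (0 : 'rV[R]_d),
    `|phi (h + z) - (phi z + edot a h)| <= e * `|h|.
  move=> e0; have := phiE; rewrite (near_shift 0) subr0/=.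
  apply: filterS => h /= phiEh.
  rewrite [X in `|X|](_ : _ = 0); last first.
    by rewrite phiEh (nbhs_singleton phiE) linearD/=; ring.
  by rewrite normr0 mulr_ge0// ltW.
have dphi : 'd phi z = edot a :> ('rV[R]_d -> R).
  by apply: diff_unique; [exact: edot_continuous|exact/eqaddoP/E].
have dfphi : differentiable phi z.
  apply/diff_locallyP; rewrite dphi.
  by split; [exact: edot_continuous|exact/eqaddoP/E].
split => //; apply/rowP => j.
by rewrite mxE deriveE// dphi edot_delta.
Qed.

(** * Topology of Euclidean balls *)

Lemma eballP {R : realType} {d : nat} {c : 'rV[R]_d} {r : R} {x : 'rV[R]_d} :
  0 < r -> eball c r x <-> edot (x - c) (x - c) < r ^+ 2.
Proof.
move=> r0; rewrite /eball/= /enorm -[X in _ < X](ger0_norm (ltW r0)).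
by rewrite -sqrtr_sqr ltr_sqrt ?exprn_gt0.
Qed.

Lemma eball_center {R : realType} {d : nat} (c : 'rV[R]_d) (r : R) :
  0 < r -> eball c r c.
Proof. by move=> r0; apply/(eballP r0); rewrite subrr linear0 exprn_gt0. Qed.

Lemma continuous_sqdist {R : realType} {d : nat} (c : 'rV[R]_d) :
  continuous (fun x : 'rV[R]_d => edot (x - c) (x - c)).
Proof.
refine (@continuous_big_add R _ d
  (fun j (x : 'rV[R]_d) => (x - c) 0 j * (x - c) 0 j) _) => j x.
have cj : {for x, continuous (fun x : 'rV[R]_d => (x - c) 0 j)}.
  rewrite (_ : (fun y => _) = (fun y : 'rV[R]_d => y 0 j - c 0 j)); last first.
    by apply/funext => y; rewrite !mxE.
  by apply: continuousB; [exact: coord_continuous|exact: cst_continuous].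
exact: continuousM.
Qed.

Lemma open_eball {R : realType} {d : nat} (c : 'rV[R]_d) (r : R) :
  0 < r -> open (eball c r).
Proof.
move=> r0; rewrite (_ : eball c r =
    (fun x => edot (x - c) (x - c)) @^-1` [set t | t < r ^+ 2]).
  by apply: open_comp; [move=> x _; exact: continuous_sqdist|exact: open_lt].
by apply/seteqP; split => x /=; move/(eballP r0).
Qed.

Lemma sqdist_shift {R : realType} {d : nat} (c v : 'rV[R]_d) (t : R) :
  edot (c + t *: v - c) (c + t *: v - c) = t ^+ 2 * edot v v.
Proof.
rewrite addrAC subrr add0r /edot mulr_sumr; apply: eq_bigr => j _.
by rewrite !mxE; ring.
Qed.

Lemma edot_ge0 {R : realType} {d : nat} (v : 'rV[R]_d) : 0 <= edot v v.
Proof. by apply: sumr_ge0 => j _; rewrite -expr2 sqr_ge0. Qed.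

Lemma continuous_line {R : realType} {d : nat} (c v : 'rV[R]_d) :
  continuous (fun t : R => c + t *: v).
Proof.
move=> t; apply: cvgD; first exact: cvg_cst.
by apply: cvgZr_tmp; exact: cvg_id.
Qed.

(** The ball is a union of segments that all contain the centre. *)
Lemma connected_eball {R : realType} {d : nat} (c : 'rV[R]_d) (r : R) :
  0 < r -> connected (eball c r).
Proof.
move=> r0; rewrite (_ : eball c r = \bigcup_(x in eball c r)
    [set c + t *: (x - c) | t in `[0, 1]]).
  apply: bigcup_connected.
    exists c => x _; exists 0; rewrite ?scale0r ?addr0//=.
    by rewrite in_itv/= lexx ler01.
  move=> x _; apply: connected_continuous_connected.
    exact: segment_connected.
  exact/continuous_subspaceT/continuous_line.
apply/seteqP; split => [x cx|y [x cx [t /=]]].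
  exists x => //; exists 1; rewrite ?scale1r ?subrKC//=.
  by rewrite in_itv/= lexx ler01.
rewrite in_itv/= => /andP[t0 t1] <-; apply/(eballP r0).
rewrite sqdist_shift; move/(eballP r0) : cx; apply: le_lt_trans.
by rewrite ler_piMl ?edot_ge0// expr_le1.
Qed.

(** * Open null sets and components of disjoint unions *)

Lemma lebesgue_null_open {R : realType} {d : nat} (U : set 'rV[R]_d) :
  open U -> lebesgue_null U -> U = set0.
Proof.
move=> oU nU; apply/seteqP; split => // x Ux; exfalso.
have /nbhs_ballP[e /= e0 xeU] : nbhs x U by exact: open_nbhs_nbhs.
(* For the sup norm the [e]-ball around [x] is the box with sides [A j], whose measure is a product
   of positive lengths. *)
pose A j := ball (x 0 j) e : set (measurableTypeR R).
have mA j : measurable (A j) by exact: measurable_realfun.measurable_ball.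
have [N [mN N0 UN]] := nU.
have : (lebesgue_tuple (R := R) d [set t | forall i, A i (tnth t i)] <= 0)%E.
  rewrite -N0; apply: le_measure; rewrite ?inE//.
    rewrite (_ : [set t | _] = \bigcap_(i in [set: 'I_d])
        (fun t : d.-tuple (measurableTypeR R) => tnth t i) @^-1` A i).
      apply: fin_bigcap_measurable => // i _.
      by rewrite -[X in measurable X]setTI; exact: measurable_tnth.
    by apply/seteqP; split => t /= h i; [move=> _|]; apply: h.
  move=> t /= tA; apply: UN => /=; apply: xeU; split => // i j.
  by rewrite ord1 mxE; exact: tA.
apply/negP; rewrite -ltNge lebesgue_tuple_box//.
elim/big_ind : _ => [|u v u0 v0|j _]; first exact: lte01.
  exact: mule_gt0.
by rewrite lebesgue_measure_ball ?ltW// lte_fin mulrn_wgt0.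
Qed.

Lemma connected_component_bigcup {T : topologicalType} {I : Type}
    (B : I -> set T) (i : I) (x : T) :
  (forall j, open (B j)) -> connected (B i) -> trivIset setT B -> B i x ->
  connected_component (\bigcup_j B j) x = B i.
Proof.
move=> oB cB tB Bix; set C := connected_component _ _.
apply/seteqP; split; last first.
  by apply: connected_component_max => // y Biy; exists i.
have CB : C `<=` \bigcup_j B j by exact: connected_component_sub.
(* [B i] is clopen relative to [C]: its trace is also that of the complement of the union of the
   other open sets. *)
suff <- : C `&` B i = C by exact: subIsetr.
apply: component_connected.
- by exists x; split => //; apply: connected_component_refl; exists i.
- by exists (B i).
- exists (~` \bigcup_(j in [set j | j <> i]) B j).
    by rewrite closedC; exact: bigcup_open.
  apply/seteqP; split => y [Cy By]; split => //.
    move=> [j /= ji Bjy]; apply: ji; apply: (tB j i) => //.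
    by exists y.
  have [j _ Bjy] := CB _ Cy; have [<- //|ji] := pselect (j = i).
  by exfalso; apply: By; exists j.
Qed.

(** * Power functions and their upper envelope *)

Definition power_fun {R : realType} {d : nat} {I : Type} (c : I -> 'rV[R]_d)
    (r : I -> R) (x : 'rV[R]_d) (i : I) : R :=
  edot (c i) x + (r i ^+ 2 - edot (c i) (c i)) / 2.

Lemma power_funE {R : realType} {d : nat} {I : Type} (c : I -> 'rV[R]_d)
    (r : I -> R) (x : 'rV[R]_d) (i : I) :
  power_fun c r x i =
  (edot x x - edot (x - c i) (x - c i) + r i ^+ 2) / 2.
Proof.
have -> : edot (x - c i) (x - c i) =
    edot x x - 2 * edot (c i) x + edot (c i) (c i).
  rewrite /edot mulr_sumr -sumrN -!big_split/=; apply: eq_bigr => j _.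
  by rewrite !mxE; ring.
by rewrite /power_fun; lra.
Qed.

Section power_envelope.
Context {R : realType} {d : nat} {I : countType}.
Context (c : I -> 'rV[R]_d) (r : I -> R).
Context (r0 : forall i, 0 < r i).
Context (tB : trivIset setT (fun i => eball (c i) (r i))).

Lemma power_fun_le_out x i : ~ eball (c i) (r i) x ->
  power_fun c r x i <= edot x x / 2.
Proof.
move=> nB; have : r i ^+ 2 <= edot (x - c i) (x - c i).
  by rewrite leNgt; apply/negP => /(eballP (r0 i)).
by rewrite power_funE; lra.
Qed.

(** For [i] different from [j], disjointness puts [x] outside ball [i], and [edot x x / 2] then
    separates the two values. *)
Lemma power_fun_le_in x i j : eball (c j) (r j) x ->
  power_fun c r x i <= power_fun c r x j.
Proof.
move=> Bjx; have [Bix|nBi] := pselect (eball (c i) (r i) x).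
  by rewrite (_ : i = j)//; apply: tB => //; exists x.
apply: (le_trans (power_fun_le_out _ _ nBi)).
by move/(eballP (r0 j)) : Bjx; rewrite power_funE; lra.
Qed.

Definition power_envelope (x : 'rV[R]_d) : R := sup (range (power_fun c r x)).

Lemma power_envelope_ub x : has_ubound (range (power_fun c r x)).
Proof.
have [[j Bjx]|nB] := pselect (exists j, eball (c j) (r j) x).
  by exists (power_fun c r x j) => _ [i _ <-]; exact: power_fun_le_in.
exists (edot x x / 2) => _ [i _ <-]; apply: power_fun_le_out => Bix.
by apply: nB; exists i.
Qed.

Lemma power_envelope_eball x i : eball (c i) (r i) x ->
  power_envelope x = power_fun c r x i.
Proof.
move=> Bix; apply/eqP; rewrite eq_le; apply/andP; split.
  apply: ge_sup; first by exists (power_fun c r x i), i.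
  by move=> _ [j _ <-]; exact: power_fun_le_in.
by apply: ub_le_sup; [exact: power_envelope_ub|exists i].
Qed.

Lemma convex_power_envelope (D : set 'rV[R]_d) :
  convex_function D power_envelope.
Proof.
move=> t x y _ _; rewrite convRE /unstable.onem.
(* Without any ball the supremum is over the empty set, whose [sup] is 0 by convention, so the
   envelope is constant. *)
have [[i0]|nI] := pselect (inhabited I); last first.
  have E z : range (power_fun c r z) = set0.
    by apply/seteqP; split => // u [i]; exfalso; apply: nI.
  by rewrite /power_envelope !E sup0 !mulr0 addr0.
apply: ge_sup; first by exists (power_fun c r (conv t x y) i0), i0.
move=> _ [i _ <-].
pose s := t%:num.
have s0 : 0 <= s by rewrite /s.
have s1 : 0 <= 1 - s by rewrite subr_ge0 /s.
have le_env z : power_fun c r z i <= power_envelope z.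
  by apply: ub_le_sup; [exact: power_envelope_ub|exists i].
(* Each [power_fun] is affine, hence commutes with convex combinations; bounding both terms by the
   envelope suffices. *)
have -> : power_fun c r (conv t x y) i =
    s * power_fun c r x i + (1 - s) * power_fun c r y i.
  rewrite /power_fun; set k := _ / 2.
  rewrite (_ : conv t x y = s *: x + (1 - s) *: y)// linearD !linearZ/=.
  ring.
by apply: lerD; apply: ler_wpM2l => //; exact: le_env.
Qed.

Lemma power_envelope_diff x i : eball (c i) (r i) x ->
  differentiable power_envelope x /\ gradient power_envelope x = c i.
Proof.
move=> Bix; apply: (near_affine_diff _ _
  ((r i ^+ 2 - edot (c i) (c i)) / 2)).
have : nbhs x (eball (c i) (r i)).
  by apply: open_nbhs_nbhs; split => //; exact: open_eball.
by apply: filterS => y; exact: power_envelope_eball.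
Qed.

End power_envelope.

(** * Density of the packing and the affine locus *)

(** If [V] missed every ball, it would be an open subset of the null remainder, hence empty. *)
Lemma full_packing_dense {R : realType} {d : nat} (Omega : set 'rV[R]_d)
    (I : countType) (c : I -> 'rV[R]_d) (r : I -> R) (V : set 'rV[R]_d) :
  full_packing Omega c r -> open V -> V `<=` Omega -> V !=set0 ->
  exists i, eball (c i) (r i) `&` V !=set0.
Proof.
move=> [_ _ _ _ nB] oV VO; apply: contraPP => /forallNP nV.
apply/nonemptyPn/lebesgue_null_open => //.
apply: negligibleS nB => t /= Vt; split; first exact: VO.
by move=> [i _ Bit]; apply: (nV i); eexists; split; eauto.
Qed.

Lemma affine_locus_power_envelope {R : realType} {d : nat}
    (Omega : set 'rV[R]_d) (I : countType) (c : I -> 'rV[R]_d) (r : I -> R) :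
  full_packing Omega c r ->
  affine_locus Omega (power_envelope c r) = \bigcup_i eball (c i) (r i).
Proof.
move=> pack; have [r0 BO tB _ _] := pack.
apply/seteqP; split => [x [Ox [U [xU UO [a [b phiE]]]]]|x [i _ Bix]]; last first.
  split; first exact: BO Bix.
  exists (eball (c i) (r i)); split => //.
    by apply: open_nbhs_nbhs; split => //; exact: open_eball.
  exists (c i), ((r i ^+ 2 - edot (c i) (c i)) / 2) => y.
  exact: power_envelope_eball.
have {xU} [V [oV Vx] VU] : exists2 V, open_nbhs x V & V `<=` U.
  by move: xU; rewrite nbhsE.
(* At such a [y] the gradient is [c i] because of the ball and [a] because of the affine formula on
   [V]. *)
have cE i y : eball (c i) (r i) y -> V y -> c i = a.
  move=> Biy Vy.
  have [_ <-] := power_envelope_diff _ _ r0 tB _ _ Biy.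
  have : nbhs y V by exact: open_nbhs_nbhs.
  move=> Vnbhs; apply: (near_affine_diff _ _ b _ _).2.
  by apply: filterS Vnbhs => z /VU; exact: phiE.
(* Both centres equal [a], so the balls share a point and disjointness forces equal indices. *)
have uniq i j y z : eball (c i) (r i) y -> V y -> eball (c j) (r j) z -> V z ->
    i = j.
  move=> Biy Vy Bjz Vz; apply: tB => //; exists (c i); split.
    exact: eball_center.
  by rewrite (cE i y)// -(cE j z)//; exact: eball_center.
have [i [y [Biy Vy]]] : exists i, eball (c i) (r i) `&` V !=set0.
  by apply: full_packing_dense pack _ _ _ => //; [exact: subset_trans UO|exists x].
exists i => //; apply: contrapT => nBix.
have lex : r i ^+ 2 <= edot (x - c i) (x - c i).
  by rewrite leNgt; apply/negP => /(eballP (r0 i)).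
pose g t := c i + t *: (x - c i).
have : \forall t \near (1 : R), V (g t).
  apply: continuous_line; rewrite scale1r subrKC.
  exact: open_nbhs_nbhs.
move=> /nbhs_ballP[e /= e0 eV].
(* Push x slightly away from c i, out of the closed ball, staying in V. *)
pose t := 1 + e / 2.
have Vgt : V (g t).
  by apply: eV; rewrite /ball/= /t opprD addNKr normrN gtr0_norm; lra.
(* [W] is open and contains [g t], so some ball meets it; by [uniq] that ball is ball [i], which [W]
   avoids. *)
pose W := V `&` [set z | r i ^+ 2 < edot (z - c i) (z - c i)].
have [j [z [Bjz [Vz]]]] : exists j, eball (c j) (r j) `&` W !=set0.
  apply: full_packing_dense pack _ _ _ => //.
  - apply: openI => //; apply: (@open_comp _ _ _ [set u | r i ^+ 2 < u]).
      by move=> z _; exact: continuous_sqdist.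
    exact: open_gt.
  - by move=> z [/VU/UO].
  - exists (g t); split => //=; rewrite sqdist_shift.
    (* Since [lex] is not strict, strictness comes from [t] exceeding 1 together with this
       positivity. *)
    have : 0 < r i ^+ 2 by rewrite exprn_gt0.
    rewrite /t; nra.
have ij := uniq i j y z Biy Vy Bjz Vz.
rewrite -ij in Bjz.
by rewrite /=; move/(eballP (r0 i)) : Bjz; lra.
Qed.

Theorem lemma9p1 (R : realType) (d : nat) (Omega : set 'rV[R]_d)
    (I : countType) (c : I -> 'rV[R]_d) (r : I -> R) :
  bounded_set Omega -> open Omega -> convex_set Omega ->
  full_packing Omega c r ->
  exists phi : 'rV[R]_d -> R,
    [/\ convex_function Omega phi,
        locally_affine_ae Omega phi,
        pieces Omega phi = range (fun i => eball (c i) (r i)) &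
        forall i y, eball (c i) (r i) y ->
          differentiable phi y /\ gradient phi y = c i].
Proof.
move=> _ _ _ pack; have [r0 BO tB oB nB] := pack.
(* Once the locus is the union of the balls, its complement is null by the packing hypothesis and
   its components are the balls. *)
have locusE := affine_locus_power_envelope _ _ _ _ pack.
have compE i x : eball (c i) (r i) x ->
    connected_component (\bigcup_i eball (c i) (r i)) x = eball (c i) (r i).
  apply: (connected_component_bigcup (fun i => eball (c i) (r i))) => //.
    by move=> j; exact: open_eball.
  exact: connected_eball.
exists (power_envelope c r); split.
- exact: convex_power_envelope.
- by rewrite /locally_affine_ae locusE.
- rewrite /pieces locusE; apply/seteqP; split => [_ [x [i _ Bix] <-]|_ [i _ <-]].
    by exists i => //; rewrite (compE i).
  exists (c i); first by exists i => //; exact: eball_center.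
  by apply: compE; exact: eball_center.
- by move=> i y; exact: power_envelope_diff.
Qed.
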